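(* Let $i\in\{1,2,3,4\}$, with $P_i$ as defined in the context, and let $n$ be a positive integer. Let $M$ be an $n$-dimensional $\mathbf{k}[x]$-module, $\tau\in\mathrm{End}_{\mathbf{k}}(M)$ the map $\tau(v)=xv$, and $p_i:M\to M$ a $\mathbf{k}$-linear map. Then $(M,p_i)$ is an $n$-dimensional $(\mathbf{k}[x],P_i)$-module if and only if there is a $\mathbf{k}$-basis of $M$ with respect to which the matrices $A$ and $B$ of $\tau$ and $p_i$, respectively, have the following forms: (i) when $i=1,4$: for some $k\in\mathbb{N}$ (with $k\le n$), $$A=\begin{bmatrix} A_1 & 0 \\ A_3 & A_4 \end{bmatrix},\qquad B=\begin{bmatrix} -I_k & 0 \\ 0 & 0 \end{bmatrix},$$ where $A_1\in M_k(\mathbf{k})$ and $A_4\in M_{n-k}(\mathbf{k})$; (ii) when $i=2,3$: for some $k\in\mathbb{N}$ (with $k\le n$), $$A=\begin{bmatrix} A_1 & A_2 \\ 0 & A_4 \end{bmatrix},\qquad B=\begin{bmatrix} -I_k & 0 \\ 0 & 0 \end{bmatrix},$$ where $A_1\in M_k(\mathbf{k})$ and $A_4\in M_{n-k}(\mathbf{k})$.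
   Context: $\mathbf{k}$ is an algebraically closed field of characteristic zero; $\mathbb{N}$ denotes the nonnegative integers. The $\mathbf{k}$-linear operators $P_i:\mathbf{k}[x]\to\mathbf{k}[x]$, which are Rota-Baxter operators of weight $1$, are given on monomials by: $P_1(x^n)=(-1)^{1-n}b^n$ for all $n\in\mathbb{N}$, where $b\in\mathbf{k}\setminus\{0\}$ is fixed; $P_2(x^n)=-x^n$ for all $n\in\mathbb{N}$; $P_3(1)=0$ and $P_3(x^n)=-x^n$ for $n\ge 1$; $P_4(1)=-1$ and $P_4(x^n)=0$ for $n\geq 1$. A $(\mathbf{k}[x],P_i)$-module is a pair $(M,p_i)$ where $M$ is a (unital) $\mathbf{k}[x]$-module and $p_i\in\mathrm{End}_{\mathbf{k}}(M)$ satisfies $P_i(f)p_i(v)=p_i(P_i(f)v+fp_i(v)+fv)$ for all $f\in\mathbf{k}[x]$, $v\in M$. The matrix of a linear map $\phi$ with respect to a basis $v_1,\dots,v_n$ is the matrix $C$ with $\phi(v_1,\dots,v_n)=(v_1,\dots,v_n)C$ (column convention). $I_k$ is the $k\times k$ identity matrix; for $k=0$ or $k=n$ the corresponding blocks are empty (so $B=0$, resp. $B=-I_n$). *)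

(* Defs.v *)
From HB Require Import structures.
From mathcomp Require Import all_boot all_order all_algebra.

Set Implicit Arguments.
Unset Strict Implicit.
Unset Printing Implicit Defensive.

Import GRing.Theory.

Local Open Scope ring_scope.

(* The underlying F-vector space of a {poly F}-module: scalars act through the
   constant polynomials. *)
Definition kspace (F : fieldType) (M : lmodType {poly F}) : Type := M.

Section KSpace.
Variables (F : fieldType) (M : lmodType {poly F}).

HB.instance Definition _ := GRing.Zmodule.on (kspace M).

Definition kscale (c : F) (v : kspace M) : kspace M := c%:P *: (v : M).

Fact kscaleA c d v : kscale c (kscale d v) = kscale (c * d) v.
Proof. by rewrite /kscale scalerA polyCM. Qed.

Fact kscale1 : left_id 1 kscale.
Proof. by move=> v; rewrite /kscale scale1r. Qed.

Fact kscaleDr : right_distributive kscale +%R.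
Proof. by move=> c u v; rewrite /kscale scalerDr. Qed.

Fact kscaleDl v : {morph kscale^~ v : c d / c + d}.
Proof. by move=> c d; rewrite /kscale polyCD scalerDl. Qed.

HB.instance Definition _ :=
  GRing.Zmodule_isLmodule.Build F (kspace M) kscaleA kscale1 kscaleDr kscaleDl.

End KSpace.

HB.mixin Record PolyModule_hasFinDim (F : fieldType) (M : Type)
    of GRing.Lmodule {poly F} M := {
  kdim : nat;
  kspace_vect_iso : Vector.axiom kdim (kspace M)
}.

(* {poly F}-modules of finite dimension over F (hence not, in general, of finite
   rank over {poly F}). *)
#[short(type="fdPolyModType")]
HB.structure Definition FdPolyModule (F : fieldType) :=
  { M of PolyModule_hasFinDim F M & GRing.Lmodule {poly F} M }.

HB.instance Definition _ (F : fieldType) (M : fdPolyModType F) :=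
  Lmodule_hasFinDim.Build F (kspace M) kspace_vect_iso.

Section MulX.
Variables (F : fieldType) (M : fdPolyModType F).

Definition mulX_fun (v : kspace M) : kspace M := 'X *: (v : M).

Fact mulX_fun_linear : linear mulX_fun.
Proof.
move=> c u v.
rewrite /mulX_fun [LHS](scalerDr _ (c%:P *: (u : M)) v) scalerA mulrC -scalerA.
by [].
Qed.

HB.instance Definition _ :=
  GRing.isLinear.Build F (kspace M) (kspace M) _ mulX_fun mulX_fun_linear.

Definition mulX : 'End(kspace M) := linfun mulX_fun.

Lemma mulXE v : mulX v = 'X *: (v : M).
Proof. by rewrite lfunE. Qed.

End MulX.

(* phi (e_1, ..., e_n) = (e_1, ..., e_n) C: columns of C are the coordinates of
   the images. Library matrices of linear maps (mxof) use rows instead. *)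
Definition matrix_in (F : fieldType) (V : vectType F) n (e : n.-tuple V)
    (phi : 'End(V)) (C : 'M[F]_n) : Prop :=
  forall j : 'I_n, phi e`_j = \sum_(i < n) C i j *: e`_i.

Definition lin_ext (F : fieldType) (g : nat -> {poly F}) (f : {poly F}) :
    {poly F} :=
  \sum_(n < size f) f`_n *: g n.

Section LinExt.
Variables (F : fieldType) (g : nat -> {poly F}).

Lemma lin_ext_wide m (f : {poly F}) :
  (size f <= m)%N -> lin_ext g f = \sum_(n < m) f`_n *: g n.
Proof.
move=> le_fm; rewrite /lin_ext (big_ord_widen m (fun n => f`_n *: g n)) //.
rewrite big_mkcond; apply: eq_bigr => n _.
by case: ltnP => // le_fn; rewrite nth_default ?scale0r.
Qed.

Lemma lin_ext_linear : linear (lin_ext g : {poly F} -> {poly F}).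
Proof.
move=> c p q; set m := maxn (size p) (size q).
have le_m : (size (c *: p + q)%R <= m)%N.
  by rewrite (leq_trans (size_polyD _ _)) // geq_max leq_max leq_maxr
             size_scale_leq.
rewrite !(@lin_ext_wide m) ?leq_maxl ?leq_maxr //.
rewrite scaler_sumr -big_split; apply: eq_bigr => n _ /=.
by rewrite coefD coefZ scalerDl scalerA.
Qed.

Lemma lin_extXn n : lin_ext g 'X^n = g n.
Proof.
rewrite /lin_ext size_polyXn big_ord_recr /= coefXn eqxx scale1r big1 ?add0r //.
by move=> i _; rewrite coefXn ltn_eqF ?scale0r.
Qed.

End LinExt.

Inductive RB_index := RB1 | RB2 | RB3 | RB4.

Definition RB_monomial (F : fieldType) (b : F) (i : RB_index) (n : nat) :
    {poly F} :=
  match i with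
  | RB1 => ((-1) ^ (1 - n%:Z) * b ^+ n)%:P
  | RB2 => - 'X^n
  | RB3 => if n == 0%N then 0 else - 'X^n
  | RB4 => if n == 0%N then -1 else 0
  end.

(* The parameter b only matters for RB1. *)
Definition RB_op (F : fieldType) (b : F) (i : RB_index) :
    {poly F} -> {poly F} :=
  lin_ext (RB_monomial b i).

Definition is_RB_module (F : fieldType) (P : {poly F} -> {poly F})
    (M : fdPolyModType F) (p : 'End(kspace M)) : Prop :=
  forall (f : {poly F}) (v : M),
    P f *: (p v : M) = p (P f *: v + f *: (p v : M) + f *: v).

(* Main.v *)
(* Put t = mulX. On f = 1 the Rota-Baxter identity says p^2 = - p, so M is the
   direct sum of im p, where p = -1, and ker p. What remains says that ker p is
   t-stable for P_1, P_4, whose values are constants, and that im p is t-stable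
   for P_2, P_3, which equal - f up to a constant: these are the vanishing
   conditions on the upper right and lower left blocks of A, in a basis adapted
   to im p and ker p. *)

Require Import Defs.
From mathcomp Require Import all_boot all_order all_algebra.

Set Implicit Arguments.
Unset Strict Implicit.
Unset Printing Implicit Defensive.

Import GRing.Theory.

Local Open Scope ring_scope.

(** * Endomorphisms with [p^2 = - p] and their block matrices *)

Section NegProjection.
Variables (F : fieldType) (V : vectType F) (n : nat).
Implicit Types (p tau : 'End(V)) (e : n.-tuple V) (k : nat).

(** The block form of [B], read on basis vectors so as to avoid casts between [k + (n - k)] and
    [n]. *)
Definition neg_block k e p : Prop :=
  forall j : 'I_n, p e`_j = if (j < k)%N then - e`_j else 0.

(** As [p] is [-1] on its image, the image meets the kernel only in 0, and by rank-nullity the two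
    fill the space. A basis of the image, listed first, is completed by one of the kernel. *)
Lemma neg_projection_basis p :
    \dim {: V} = n -> (p \o p)%VF = - p ->
  exists2 e : n.-tuple V, basis_of {: V} e &
  exists2 k, (k <= n)%N & neg_block k e p.
Proof.
move=> dimV pp.
have ppE v : p (p v) = - p v by rewrite -comp_lfunE pp opp_lfunE.
have p_img v : v \in limg p -> p v = - v.
  by case/memv_imgP=> u _ ->; rewrite ppE.
have dir : (limg p :&: lker p = 0)%VS.
  apply/eqP; rewrite -subv0; apply/subvP=> v.
  rewrite memv_cap memv_ker => /andP[/p_img->].
  by rewrite memv0 oppr_eq0.
have dimD : (\dim (limg p) + \dim (lker p) = n)%N.
  by rewrite addnC -dimV -(limg_ker_dim p fullv) capfv.
have full : (limg p + lker p = fullv)%VS.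
  by apply/eqP; rewrite eqEdim subvf dimv_disjoint_sum // dimD dimV /=.
pose X := vbasis (limg p); pose Y := vbasis (lker p).
have size_XY : size (X ++ Y) == n by rewrite size_cat !size_tuple dimD.
exists (Tuple size_XY).
  move/directv_addP: dir => /cat_basis/(_ (vbasisP _) (vbasisP _)).
  by rewrite full.
exists (\dim (limg p)); first by rewrite -dimD leq_addr.
move=> j /=; rewrite nth_cat size_tuple; case: ltnP => lt_jk.
  by rewrite p_img // vbasis_mem // mem_nth ?size_tuple.
apply/eqP; rewrite -memv_ker vbasis_mem // mem_nth // size_tuple.
by rewrite ltn_subLR // dimD.
Qed.

Lemma matrix_inP e phi (C : 'M_n) : basis_of {: V} e ->
  matrix_in e phi C <-> (forall i j, C i j = coord e i (phi e`_j)).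
Proof.
move=> be; have fe := basis_free be; split=> [phiE i j | CE j].
  by rewrite phiE coord_sum_free.
rewrite {1}(coord_basis be (memvf (phi e`_j))).
by apply: eq_bigr => i _; rewrite CE.
Qed.

Lemma eq_lfun_basis e (phi psi : 'End(V)) : basis_of {: V} e ->
  (forall j : 'I_n, phi e`_j = psi e`_j) -> phi = psi.
Proof.
move=> be eq_e; apply/lfunP=> v; rewrite (coord_basis be (memvf v)) !linear_sum.
by apply: eq_bigr => j _; rewrite !linearZ /= eq_e.
Qed.

Lemma eq_coord_basis e u v : basis_of {: V} e ->
  (forall i : 'I_n, coord e i u = coord e i v) -> u = v.
Proof.
move=> be eq_uv.
rewrite (coord_basis be (memvf u)) (coord_basis be (memvf v)).
by apply: eq_bigr => i _; rewrite eq_uv.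
Qed.

Lemma matrix_in_neg_block k (le_kn : (k <= n)%N) e p : basis_of {: V} e ->
  matrix_in e p (castmx (subnKC le_kn, subnKC le_kn)
                        (block_mx (- 1%:M) 0 0 0)) <-> neg_block k e p.
Proof.
move=> be; have fe := basis_free be.
have CE i j : castmx (subnKC le_kn, subnKC le_kn)
    (block_mx (- 1%:M) 0 0 0 : 'M[F]_(k + (n - k))) i j =
    if (j < k)%N then - (i == j)%:R else 0.
  rewrite castmxE; set i' := cast_ord _ i; set j' := cast_ord _ j.
  have -> : (i == j) = (i' == j') by rewrite (inj_eq (@cast_ord_inj _ _ _)).
  (* Exposes the test as [j' < k], the boolean that [split_ordP] decides together with the block of
     [j']. *)
  rewrite -[nat_of_ord j]/(nat_of_ord j').
  case: (split_ordP i') => i1 ->; case: (split_ordP j') => j1 ->.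
  - by rewrite block_mxEul !mxE (inj_eq (@lshift_inj _ _)).
  - by rewrite block_mxEur mxE.
  - by rewrite block_mxEdl mxE eq_rlshift oppr0.
  - by rewrite block_mxEdr mxE.
apply: (iff_trans (matrix_inP _ _ be)); split=> [pE j | pE i j].
  apply: (eq_coord_basis be) => i; rewrite -pE CE.
  by case: ifP; rewrite ?linear0 // linearN /= coord_free // eq_sym.
by rewrite CE pE; case: ifP; rewrite ?linear0 // linearN /= coord_free // eq_sym.
Qed.

(** * Vanishing blocks of [tau] as identities between [p] and [tau] *)

Section Blocks.
Variables (k : nat) (le_kn : (k <= n)%N) (e : n.-tuple V) (p tau : 'End(V)).
Hypotheses (be : basis_of {: V} e) (pE : neg_block k e p).

Lemma coord_neg_block i v :
  coord e i (p v) = if (i < k)%N then - coord e i v else 0.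
Proof.
have fe := basis_free be.
rewrite {1}(coord_basis be (memvf v)) !linear_sum /= (bigD1 i) //=.
rewrite !linearZ /= pE big1 ?addr0 => [|j ne_ji].
  by case: ifP; rewrite ?linear0 ?mulr0 // linearN /= coord_free ?eqxx // mulrN1.
rewrite !linearZ /= pE; case: ifP; rewrite ?linear0 ?mulr0 // linearN /=.
by rewrite coord_free // (negPf ne_ji) oppr0 mulr0.
Qed.

Lemma neg_block_idem : (p \o p)%VF = - p.
Proof.
apply/lfunP=> v; rewrite comp_lfunE opp_lfunE; apply: (eq_coord_basis be) => i.
by rewrite linearN /= !coord_neg_block; case: (i < k)%N; rewrite ?oppr0.
Qed.

Variable A : 'M[F]_(k + (n - k)).
Hypothesis tauE : matrix_in e tau (castmx (subnKC le_kn, subnKC le_kn) A).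

Lemma block_coord i j : A i j =
  coord e (cast_ord (subnKC le_kn) i) (tau e`_(cast_ord (subnKC le_kn) j)).
Proof.
by have /(matrix_inP _ _ be)<- := tauE; rewrite castmxE !cast_ordK.
Qed.

(** [p + \1] kills the first [k] basis vectors and fixes the others, and [p] keeps, up to sign, only
    the first [k] coordinates: the composite carries exactly the upper right block. *)
Lemma ursubmx_eq0P :
  ursubmx A = 0 <-> (p \o tau \o (p + \1))%VF = 0.
Proof.
split=> [A0 | pt0].
  apply: (eq_lfun_basis be) => j.
  rewrite !comp_lfunE add_lfunE id_lfunE zero_lfunE pE.
  case: ltnP => [_ | le_kj]; first by rewrite addNr !linear0.
  rewrite add0r; apply: (eq_coord_basis be) => i; rewrite coord_neg_block linear0.
  case: ifP => // lt_ik.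
  have lt_j : (j - k < n - k)%N by rewrite ltn_sub2r // (leq_ltn_trans le_kj).
  have := congr1 (fun B : 'M_(_, _) => B (Ordinal lt_ik) (Ordinal lt_j)) A0.
  rewrite !mxE block_coord.
  rewrite (_ : cast_ord _ (lshift _ _) = i) /=; last exact: val_inj.
  by rewrite subnKC // => ->; rewrite oppr0.
apply/matrixP=> i j; rewrite !mxE block_coord; set i' := cast_ord _ _.
have /(congr1 (fun f : 'End(V) => coord e i' (f e`_(k + j)))) := pt0.
have lt_j : (k + j < n)%N by rewrite -ltn_subRL.
rewrite !comp_lfunE add_lfunE id_lfunE zero_lfunE (pE (Ordinal lt_j)) /=.
rewrite ltnNge leq_addr /= add0r coord_neg_block /= ltn_ord linear0.
by move/eqP; rewrite oppr_eq0 => /eqP.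
Qed.

(** On a basis vector of index [j < k] the identity says that [p] negates [tau e_j], so that this
    vector has no coordinate of index at least [k]; on the others both sides vanish. *)
Lemma dlsubmx_eq0P :
  dlsubmx A = 0 <-> (p \o tau \o p)%VF = - (tau \o p)%VF.
Proof.
split=> [A0 | ptp].
  apply: (eq_lfun_basis be) => j.
  rewrite opp_lfunE !comp_lfunE pE.
  case: ltnP => [lt_jk | _]; last by rewrite !linear0.
  rewrite !linearN /=; congr (- _); apply: (eq_coord_basis be) => i.
  rewrite coord_neg_block linearN; case: ltnP => // le_ki.
  have lt_i : (i - k < n - k)%N by rewrite ltn_sub2r // (leq_ltn_trans le_ki).
  have := congr1 (fun B : 'M_(_, _) => B (Ordinal lt_i) (Ordinal lt_jk)) A0.
  rewrite !mxE block_coord /=.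
  rewrite (_ : cast_ord _ (rshift _ _) = i) => [->|]; first by rewrite oppr0.
  by apply: val_inj; rewrite /= subnKC.
apply/matrixP=> i j; rewrite !mxE block_coord; set i' := cast_ord _ _.
have /(congr1 (fun f : 'End(V) => coord e i' (f e`_j))) := ptp.
have lt_j : (j < n)%N by rewrite (leq_trans (ltn_ord j)).
rewrite opp_lfunE !comp_lfunE (pE (Ordinal lt_j)) /= ltn_ord !linearN /=.
by rewrite coord_neg_block /= ltnNge leq_addr /= oppr0 opprK => <-.
Qed.

End Blocks.

Lemma exists_matrix_in k (le_kn : (k <= n)%N) e tau : basis_of {: V} e ->
  exists A : 'M[F]_(k + (n - k)),
    matrix_in e tau (castmx (subnKC le_kn, subnKC le_kn) A).
Proof.
move=> be; exists (castmx (esym (subnKC le_kn), esym (subnKC le_kn))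
  (\matrix_(i, j) coord e i (tau e`_j))).
by rewrite castmxKV; apply/(matrix_inP _ _ be) => i j; rewrite mxE.
Qed.

End NegProjection.

(** * Closed forms of the four operators *)

Section Operators.
Variables (F : fieldType) (b : F).
Implicit Type f : {poly F}.

Lemma RB_opE i f : RB_op b i f =
  match i with
  | RB1 => - f.[- b]%:P
  | RB2 => - f
  | RB3 => (f`_0)%:P - f
  | RB4 => - (f`_0)%:P
  end.
Proof.
(* One term more than [size f], so that the term of degree 0 can be split off even when [f = 0]. *)
have -> : RB_op b i f = \sum_(m < (size f).+1) f`_m *: RB_monomial b i m.
  exact: lin_ext_wide.
have fE : f = \sum_(m < (size f).+1) f`_m *: 'X^m.
  rewrite -poly_def; apply/polyP=> m; rewrite coef_poly ltnS.
  by case: leqP => // /ltnW /leq_sizeP ->.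
case: i => /=.
- rewrite (@horner_coef_wide _ (size f).+1) // rmorph_sum -sumrN.
  apply: eq_bigr => m _; rewrite -mul_polyC -polyCM -polyCN; congr _%:P.
  rewrite -mulrN; congr (_ * _).
  (* The integer exponent [1 - m] may be negative, but [-1] is its own inverse. *)
  rewrite [LHS](_ : _ = - (-1) ^+ m * b ^+ m); last first.
    congr (_ * _); rewrite expfzDr ?oppr_eq0 ?oner_eq0 // expr1z mulN1r.
    by rewrite -exprz_inv invrN1.
  by rewrite mulNr -exprNn.
- rewrite [in RHS]fE -sumrN; apply: eq_bigr => m _; exact: scalerN.
- rewrite [in X in _ - X]fE !big_ord_recl /= expr0 scaler0 add0r alg_polyC.
  rewrite opprD addrA subrr add0r -sumrN.
  by apply: eq_bigr => m _; exact: scalerN.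
- rewrite big_ord_recl /= big1 => [|m _]; last exact: scaler0.
  by rewrite addr0 scalerN alg_polyC.
Qed.

End Operators.

(** * Reduction of the Rota-Baxter identity to [f = 1] and [f = 'X] *)

Section Modules.
Variables (F : fieldType) (M : fdPolyModType F) (p : 'End(kspace M)).

Lemma kspace_linearZ c (v : M) : p (c%:P *: v) = c%:P *: (p v : M).
Proof. exact: (linearZZ p c (v : kspace M)). Qed.

Lemma kspace_linearD (u v : M) : p (u + v) = (p u : M) + (p v : M).
Proof. exact: (linearD p (u : kspace M)). Qed.

Lemma kspace_linearN (v : M) : p (- v) = - (p v : M).
Proof. exact: (linearN p (v : kspace M)). Qed.

(** The constant [c f] commutes with [p] and cancels, leaving [p (f (p v + v)) = 0]. Once
    [p^2 = - p], the vectors [p v + v] lie in [ker p], so stability of [ker p] under ['X]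
    suffices. *)
Lemma RB_module_constP (c : {poly F} -> F) :
    is_RB_module (fun f => - (c f)%:P) p <->
  (p \o p)%VF = - p /\ (p \o mulX M \o (p + \1))%VF = 0.
Proof.
have RBE : is_RB_module (fun f => - (c f)%:P) p <->
    (forall f (v : M), p (f *: ((p v : M) + v)) = 0).
  by split=> RB f v; move: (RB f v);
     rewrite -polyCN -addrA kspace_linearD kspace_linearZ -scalerDr;
     [rewrite -{1}[_ *: _]addr0 => /addrI | move=> ->; rewrite addr0].
apply: (iff_trans RBE); split=> [p0 | [pp ptp]].
  split; apply/lfunP => v.
    rewrite opp_lfunE comp_lfunE; apply/eqP; rewrite -addr_eq0; apply/eqP.
    by have := p0 1 v; rewrite scale1r kspace_linearD.
  by rewrite zero_lfunE !comp_lfunE add_lfunE id_lfunE mulXE p0.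
move=> f v; set w := _ + v; have: p w = 0.
  have /lfunP/(_ v) := pp; rewrite comp_lfunE opp_lfunE => ppv.
  by rewrite kspace_linearD ppv addNr.
(* [w] ranges over all of [ker p], since the case of [f * 'X + c'] uses the hypothesis at ['X *: w],
   which [ptp] puts back in the kernel. *)
move: w; elim/poly_ind: f => [|f c' IHf] w pw.
  by rewrite scale0r; exact: linear0.
rewrite scalerDl kspace_linearD kspace_linearZ pw scaler0 addr0 -scalerA IHf //.
have /lfunP/(_ w) := ptp.
by rewrite !comp_lfunE add_lfunE id_lfunE zero_lfunE pw add0r mulXE.
Qed.

(** The constant cancels again, and so do the two terms in [f *: v]. What is left says that [p]
    negates [f *: p v]; since [p] negates exactly its image, this is stability of [im p], to be
    checked for ['X] only. *)
Lemma RB_module_subP (c : {poly F} -> F) :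
    is_RB_module (fun f => (c f)%:P - f) p <->
  (p \o p)%VF = - p /\ (p \o mulX M \o p)%VF = - (mulX M \o p)%VF.
Proof.
have RBE : is_RB_module (fun f => (c f)%:P - f) p <->
    (forall f (v : M), p (f *: (p v : M)) = - (f *: (p v : M))).
  by split=> RB f v; move: (RB f v);
     rewrite !scalerBl addrAC subrK kspace_linearD kspace_linearZ;
     [move/addrI | move=> ->].
apply: (iff_trans RBE); split=> [pf | [pp ptp]].
  split; apply/lfunP => v; rewrite opp_lfunE !comp_lfunE.
    by have := pf 1 v; rewrite scale1r.
  by rewrite !mulXE pf.
move=> f v; set w : M := p v; have: p w = - w.
  by have /lfunP/(_ v) := pp; rewrite comp_lfunE opp_lfunE.
move: w; elim/poly_ind: f => [|f c' IHf] w pw.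
  by rewrite scale0r oppr0; exact: linear0.
rewrite scalerDl kspace_linearD kspace_linearZ pw scalerN opprD -scalerA.
rewrite IHf //.
(* Since [p w = - w], the identity at [w] is the required one up to a common sign. *)
have /lfunP/(_ w) := ptp.
rewrite opp_lfunE !comp_lfunE pw !mulXE scalerN kspace_linearN.
exact: oppr_inj.
Qed.

End Modules.

Theorem theorem2p12 (F : closedFieldType) (charF : [pchar F] =i pred0)
    (b : F) (b_neq0 : b != 0) (i : RB_index) (n : nat) (n_gt0 : (0 < n)%N)
    (M : fdPolyModType F) (dimM : \dim {: kspace M} = n)
    (p : 'End(kspace M)) :
  is_RB_module (RB_op b i) p <->
  exists2 e : n.-tuple (kspace M), basis_of {: kspace M} e &
  exists (k : nat) (le_kn : (k <= n)%N) (A B : 'M[F]_(k + (n - k))),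
    [/\ matrix_in e (mulX M) (castmx (subnKC le_kn, subnKC le_kn) A),
        matrix_in e p (castmx (subnKC le_kn, subnKC le_kn) B),
        match i with
        | RB1 | RB4 =>
            exists (A1 : 'M[F]_k) (A3 : 'M[F]_(n - k, k)) (A4 : 'M[F]_(n - k)),
              A = block_mx A1 0 A3 A4
        | RB2 | RB3 =>
            exists (A1 : 'M[F]_k) (A2 : 'M[F]_(k, n - k)) (A4 : 'M[F]_(n - k)),
              A = block_mx A1 A2 0 A4
        end &
        B = block_mx (- 1%:M) 0 0 0].
Proof.
(* The closed forms are pointwise equalities; this transports the module condition along them
   without functional extensionality. *)
have RB_ext P Q : P =1 Q -> is_RB_module P p <-> is_RB_module Q p.
  by move=> PQ; split=> RB f v; have := RB f v; rewrite PQ.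
have conds : is_RB_module (RB_op b i) p <-> (p \o p)%VF = - p /\
    match i with
    | RB1 | RB4 => (p \o mulX M \o (p + \1))%VF = 0
    | RB2 | RB3 => (p \o mulX M \o p)%VF = - (mulX M \o p)%VF
    end.
  apply: (iff_trans (RB_ext _ _ (RB_opE b i))); case: i => /=.
  - exact: RB_module_constP (fun f => f.[- b]).
  - apply: iff_trans (RB_module_subP p (fun=> 0)).
    by apply: RB_ext => f; rewrite sub0r.
  - exact: RB_module_subP (fun f => f`_0).
  - exact: RB_module_constP (fun f => f`_0).
apply: (iff_trans conds); split=> [[pp ptau] | [e be [k [le_kn [A [B [tauE pE shapeA BE]]]]]]].
  have [e be [k le_kn pE]] := neg_projection_basis dimM pp.
  have [A tauE] := exists_matrix_in le_kn (mulX M) be.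
  exists e => //; exists k, le_kn, A, (block_mx (- 1%:M) 0 0 0).
  split=> //; first exact/matrix_in_neg_block.
  have urP := ursubmx_eq0P be pE tauE; have dlP := dlsubmx_eq0P be pE tauE.
  case: i ptau {conds} => [/urP|/dlP|/dlP|/urP] A0.
  - by exists (ulsubmx A), (dlsubmx A), (drsubmx A); rewrite -A0 submxK.
  - by exists (ulsubmx A), (ursubmx A), (drsubmx A); rewrite -A0 submxK.
  - by exists (ulsubmx A), (ursubmx A), (drsubmx A); rewrite -A0 submxK.
  - by exists (ulsubmx A), (dlsubmx A), (drsubmx A); rewrite -A0 submxK.
(* Conversely, [B] determines [p] on the basis, whence [p^2 = - p], and the zero block of [A] gives
   the remaining identity. *)
move: pE; rewrite BE => /(matrix_in_neg_block _ _ be) pE.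
have urP := ursubmx_eq0P be pE tauE; have dlP := dlsubmx_eq0P be pE tauE.
split; first exact: neg_block_idem be pE.
case: i shapeA {conds} => [[A1 [A3 [A4 AE]]]|[A1 [A2 [A4 AE]]]
  |[A1 [A2 [A4 AE]]]|[A1 [A3 [A4 AE]]]].
- by apply/urP; rewrite AE block_mxKur.
- by apply/dlP; rewrite AE block_mxKdl.
- by apply/dlP; rewrite AE block_mxKdl.
- by apply/urP; rewrite AE block_mxKur.
Qed.
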